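(* Let $n\geq 1$ and let $A, B, C\in \mathbb{C}^{n\times n}$ be positive definite matrices. Define $$M=A(2A+B)^{-1} +B(2B+C)^{-1} + C(2C+A)^{-1}.$$ Then $Tr(M)\leq \frac{3n-1}{2}$.
   Context: A matrix $A\in\mathbb{C}^{n\times n}$ is called positive definite if it is Hermitian and $x^*Ax>0$ for all $0\neq x\in\mathbb{C}^n$. $Tr$ denotes the trace; the trace in the claim is real. *)

(* Defs.v *)
From HB Require Import structures.
From mathcomp Require Import all_boot all_order all_algebra.
From mathcomp Require Import sesquilinear spectral.

Set Implicit Arguments.
Unset Strict Implicit.
Unset Printing Implicit Defensive.

Import Order.TTheory GRing.Theory Num.Theory.
Local Open Scope ring_scope.
Local Open Scope sesquilinear_scope.

(* In a numClosedFieldType, 0 < z also asserts that z is real. *)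
Definition posdefmx (C : numClosedFieldType) (n : nat) (A : 'M[C]_n) : Prop :=
  A \is hermsymmx /\ forall x : 'cV[C]_n, x != 0 -> 0 < (x ^t* *m A *m x) 0 0.

(* Main.v *)
(* Since 2A(2A+B)^-1 = I - B(2A+B)^-1, it suffices to bound below by 1 the sum
   of the traces Tr(B(2A+B)^-1) over the three cyclic terms. For positive
   definite B and S one has Tr(B S^-1) >= x*Bx / x*Sx for every x != 0; using
   the same x in all three terms reduces the claim to the scalar case
   b/(2a+b) + c/(2b+c) + a/(2c+a) >= 1 with a = x*Ax, b = x*Bx, c = x*Cx. *)
Require Import Defs.
From mathcomp Require Import all_boot all_order all_algebra.
From mathcomp Require Import reals complex.
From mathcomp Require Import sesquilinear spectral ring.

Set Implicit Arguments.
Unset Strict Implicit.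
Unset Printing Implicit Defensive.

Import Order.TTheory GRing.Theory Num.Theory.
Local Open Scope ring_scope.
Local Open Scope complex_scope.

Section SesquilinearForms.
Local Open Scope ring_scope.
Local Open Scope sesquilinear_scope.
Variables (F : numClosedFieldType) (n : nat).
Implicit Types (A B S : 'M[F]_n) (x y z : 'cV[F]_n).

Definition mxform A x y : F := (x ^t* *m A *m y) 0 0.

Lemma hermsymmx_trmxC A : A \is hermsymmx -> A ^t* = A.
Proof. by move/is_hermitianmxP => {2}->; rewrite expr0 scale1r. Qed.

Lemma conj_mxentry m p (M : 'M[F]_(m, p)) i j : (M i j)^* = (M ^t*) j i.
Proof. by rewrite !mxE. Qed.

Lemma mxform_conj A x y : A \is hermsymmx -> (mxform A x y)^* = mxform A y x.
Proof.
move=> /hermsymmx_trmxC hA.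
by rewrite conj_mxentry !trmx_mul !map_mxM trmxCK hA mulmxA.
Qed.

Lemma mxformDl A B x y : mxform (A + B) x y = mxform A x y + mxform B x y.
Proof. by rewrite /mxform mulmxDr mulmxDl mxE. Qed.

Lemma mxformZl c A x y : mxform (c *: A) x y = c * mxform A x y.
Proof. by rewrite /mxform -scalemxAr -scalemxAl mxE. Qed.

Lemma mxform_comb A (a b : F) x y : a \is Num.real ->
  mxform A (a *: x - b *: y) (a *: x - b *: y) =
  a ^+ 2 * mxform A x x - a * b * mxform A x y
  - a * b^* * mxform A y x + b * b^* * mxform A y y.
Proof.
move=> /CrealP ar; rewrite /mxform.
have -> : (a *: x - b *: y) ^t* = a *: x ^t* - b^* *: y ^t*.
  by apply/matrixP => i j; rewrite !mxE rmorphB !rmorphM /= ar.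
rewrite !(mulmxDl, mulmxDr, mulNmx, mulmxN) -!(scalemxAl, scalemxAr) !mxE; ring.
Qed.

Lemma posdefmx_form_ge0 S x : posdefmx S -> 0 <= mxform S x x.
Proof.
case=> _ hS; have [->|/hS/ltW //] := eqVneq x 0.
by rewrite /mxform mulmx0 mxE.
Qed.

(** With [a] = y^* S y and [b] = y^* S x, the vector a x - b y is [a] times the part of [x] that is
    [S]-orthogonal to [y]; the form is nonnegative there, and the factor a > 0 cancels. *)
Lemma posdefmx_Cauchy_Schwarz S x y : posdefmx S -> y != 0 ->
  `|mxform S y x| ^+ 2 <= mxform S x x * mxform S y y.
Proof.
move=> hS y0; have a_gt0 : 0 < mxform S y y by case: hS => _; apply.
set a := mxform S y y in a_gt0 *; set b := mxform S y x.
have := posdefmx_form_ge0 (a *: x - b *: y) hS.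
rewrite mxform_comb ?gtr0_real // -(mxform_conj _ _ hS.1 : b^* = _) -/a -/b.
have -> : a ^+ 2 * mxform S x x - a * b * b^* - a * b^* * b + b * b^* * a
   = a * (mxform S x x * a - b * b^*) by ring.
by rewrite pmulr_rge0 // subr_ge0 normCK.
Qed.

Lemma posdefmx_unit S : posdefmx S -> S \in unitmx.
Proof.
case=> _ hS; rewrite -row_free_unit; apply: inj_row_free => v vS0.
apply/eqP; apply: contraT => v0; have := hS (v ^t*).
rewrite trmxCK vS0 mul0mx mxE ltxx => -> //.
apply: contraNneq v0 => /(congr1 (fun M => M ^t*)).
by rewrite trmxCK trmx0 map_mx0 => ->.
Qed.

Lemma posdefmx_comb A B : posdefmx A -> posdefmx B -> posdefmx (2 *: A + B).
Proof.
move=> [hA pA] [hB pB]; split.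
  apply/is_hermitianmxP; rewrite expr0 scale1r linearD linearZ /= map_mxD map_mxZ.
  by rewrite !hermsymmx_trmxC // rmorph_nat.
move=> x x0; rewrite -/(mxform _ x x) mxformDl mxformZl.
by rewrite addr_gt0 ?mulr_gt0 ?ltr0n // ?pA ?pB.
Qed.

(** Serves a unitary [P] diagonalizing [B], where the columns of [P ^t*] are orthonormal
    eigenvectors of [B]. *)
Lemma mxform_col A (P : 'M[F]_n) i :
  mxform A (col i (P ^t*)) (col i (P ^t*)) = (P *m A *m P ^t*) i i.
Proof.
rewrite /mxform.
have -> : (col i (P ^t*)) ^t* = row i P.
  by apply/matrixP => a b; rewrite !mxE conjCK.
by rewrite -row_mul colE mulmxA -colE -row_mul 2![LHS]mxE.
Qed.

(* With [B = \sum_i d_i v_i v_i^*] and [d_i >= 0], the claim splits into the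
   inequalities [|v_i^* x|^2 <= (v_i^* S^-1 v_i) (x^* S x)], which are
   Cauchy-Schwarz for [S] at the vectors [S^-1 v_i] and [x]. *)
Lemma mxtrace_form B S x : posdefmx B -> posdefmx S -> x != 0 ->
  mxform B x x <= \tr (B *m invmx S) * mxform S x x.
Proof.
move=> hB hS x0; have uS := posdefmx_unit hS.
have /orthomx_spectralP := hermitian_normalmx hB.1.
set P := spectralmx B; set d := spectral_diag B.
have Pu : P \is unitarymx := spectral_unitarymx B.
rewrite invmx_unitary // => eB.
have PPt : P *m P ^t* = 1%:M by apply/unitarymxP.
pose v i := col i (P ^t*).
have d_ge0 i : 0 <= d 0 i.
  (* The eigenvalue [d 0 i] is the value of the form of [B] at the unit eigenvector [v i]. *)
  have := posdefmx_form_ge0 (v i) hB.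
  rewrite mxform_col eB !mulmxA PPt mul1mx -mulmxA PPt mulmx1.
  by rewrite mxE eqxx mulr1n.
have -> : mxform B x x = \sum_i d 0 i * `|(P *m x) i 0| ^+ 2.
  rewrite /mxform eB !mulmxA -2!mulmxA.
  have -> : x ^t* *m P ^t* = (P *m x) ^t* by rewrite trmx_mul map_mxM.
  rewrite mxE; apply: eq_bigr => i _.
  by rewrite mul_diag_mx mxE -conj_mxentry normCK mulrCA [_^* * _]mulrC.
have -> : \tr (B *m invmx S) = \sum_i d 0 i * mxform (invmx S) (v i) (v i).
  (* Cyclicity moves [P ^t*] to the right, leaving the trace of diag(d) P S^-1 P^*. *)
  rewrite eB -!mulmxA mxtrace_mulC -!mulmxA /mxtrace; apply: eq_bigr => i _.
  by rewrite mul_diag_mx mxE mxform_col !mulmxA.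
rewrite mulr_suml; apply: ler_sum => i _; rewrite -mulrA ler_wpM2l //.
pose w := invmx S *m v i.
have Sw : S *m w = v i by rewrite mulmxA mulmxV // mul1mx.
have -> : mxform (invmx S) (v i) (v i) = mxform S w w.
  (* As w^* S w is real, it equals its conjugate, which is (w^* v_i)^* = v_i^* S^-1 v_i. *)
  rewrite -(mxform_conj w w hS.1) /mxform -(mulmxA _ S w) Sw.
  by rewrite conj_mxentry trmx_mul map_mxM trmxCK mulmxA.
have := posdefmx_Cauchy_Schwarz w hS x0.
suff -> : `|mxform S x w| = `|(P *m x) i 0| by [].
rewrite /mxform -(mulmxA _ S w) Sw /v colE mulmxA -colE mxE.
have -> : x ^t* *m P ^t* = (P *m x) ^t* by rewrite trmx_mul map_mxM.
by rewrite -conj_mxentry norm_conjC.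
Qed.

End SesquilinearForms.

Lemma cyclic_fraction_sum (F : numFieldType) (a b c : F) :
  0 < a -> 0 < b -> 0 < c ->
  1 <= b / (2 * a + b) + c / (2 * b + c) + a / (2 * c + a).
Proof.
move=> a0 b0 c0; set s := a + b + c.
have s0 : 0 < s by rewrite !addr_gt0.
(* Since [sum q (2p + q) = s^2] over the cyclic pairs, bounding [w^-1] below by
   its tangent at [w = s] loses nothing in the sum. *)
have tangent (p q : F) : 0 < p -> 0 < q ->
    2 * q / s - q * (2 * p + q) / s ^+ 2 <= q / (2 * p + q).
  move=> p0 q0; have w0 : 0 < 2 * p + q by rewrite addr_gt0 ?mulr_gt0 ?ltr0n.
  rewrite -subr_ge0.
  have -> : q / (2 * p + q) - (2 * q / s - q * (2 * p + q) / s ^+ 2)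
     = q * (2 * p + q) * ((2 * p + q)^-1 - s^-1) ^+ 2.
    by field; rewrite !gt_eqF.
  apply: mulr_ge0; first by rewrite mulr_ge0 ?ltW.
  by apply: real_exprn_even_ge0; rewrite // rpredB // gtr0_real ?invr_gt0.
apply: le_trans (lerD (lerD (tangent a b a0 b0) (tangent b c b0 c0))
  (tangent c a c0 a0)).
(* The three tangent bounds sum to 2 s / s - s^2 / s^2 = 1. *)
rewrite le_eqVlt; apply/orP; left; apply/eqP.
by rewrite /s; field; rewrite gt_eqF.
Qed.

(* The order of R[i] relates only numbers with equal imaginary parts, so the
   conclusion includes that the trace is real. *)
Theorem theorem2p13 (R : realType) (n : nat) (hn : (1 <= n)%N)
    (A B C : 'M[R[i]]_n)
    (hA : posdefmx A) (hB : posdefmx B) (hC : posdefmx C) :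
  let M := A *m invmx (2 *: A + B) + B *m invmx (2 *: B + C)
           + C *m invmx (2 *: C + A) in
  \tr M <= (3 * n%:R - 1) / 2.
Proof.
(* Any nonzero vector would do; the all-ones vector is nonzero because n >= 1. *)
cbv zeta; pose x : 'cV[R[i]]_n := const_mx 1.
have x0 : x != 0.
  apply/eqP => /matrixP /(_ (Ordinal hn) 0); rewrite !mxE.
  by apply/eqP; rewrite oner_eq0.
have term A' B' : posdefmx A' -> posdefmx B' ->
    mxform B' x x / (2 * mxform A' x x + mxform B' x x)
    <= n%:R - 2 * \tr (A' *m invmx (2 *: A' + B')).
  move=> hA' hB'; have hS := posdefmx_comb hA' hB'.
  have := mxtrace_form hB' hS x0.
  rewrite mxformDl mxformZl -ler_pdivrMr; last first.
    by rewrite -mxformZl -mxformDl; case: hS => _; apply.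
  suff -> : \tr (B' *m invmx (2 *: A' + B')) =
     n%:R - 2 * \tr (A' *m invmx (2 *: A' + B')) by [].
  rewrite -mxtraceZ -[n%:R]mxtrace1 -raddfB /= -(mulmxV (posdefmx_unit hS)).
  by rewrite scalemxAl -mulmxBl addrAC subrr add0r.
have := le_trans (cyclic_fraction_sum (hA.2 x x0) (hB.2 x x0) (hC.2 x x0))
  (lerD (lerD (term _ _ hA hB) (term _ _ hB hC)) (term _ _ hC hA)).
(* The summed bounds give 1 <= 3n - 2 Tr(M); this and the goal both say that 3n - 1 - 2 Tr(M) is
   nonnegative. *)
rewrite ler_pdivlMr ?ltr0n // !mxtraceD -subr_ge0 => h.
rewrite -subr_ge0; apply: le_trans h _.
rewrite le_eqVlt; apply/orP; left; apply/eqP; ring.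
Qed.
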